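(* The edge variant of subgraph reconfiguration under each of the TJ and TS rules can be solved in linear time for the property ''a graph is a clique.''
   Context: Graphs are finite, simple and undirected. In the edge variant for property $\Pi$ on a graph $G$, a feasible solution is an edge subset $E'\subseteq E(G)$ such that the graph formed by $E'$ (edge set $E'$ together with all endpoints of its edges) satisfies $\Pi$; here $\Pi$ is ''the graph is a complete graph.'' Under the token jumping (TJ) rule, two feasible solutions $X,Y$ are adjacent if $|X\setminus Y|=|Y\setminus X|=1$; under the token sliding (TS) rule, they are adjacent if additionally the edge in $X\setminus Y$ and the edge in $Y\setminus X$ share an endpoint. A reconfiguration sequence is a sequence of feasible solutions in which consecutive ones are adjacent. The problem: given $G$ and feasible source and target solutions $E_s,E_t$, decide whether a reconfiguration sequence from $E_s$ to $E_t$ exists. *)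

(* Defs.v *)
From mathcomp Require Import all_boot.

Set Implicit Arguments.
Unset Strict Implicit.
Unset Printing Implicit Defensive.

(** * Graphs and edge-variant subgraph reconfiguration *)

(* A graph property is a predicate on pairs (vertex set, edge set), an edge
   being a two-element set of vertices. *)
Definition graph_property : Type :=
  forall T : finType, {set T} -> {set {set T}} -> bool.

Definition complete_graph : graph_property := fun T V E =>
  [forall x in V, forall y in V, (x != y) ==> ([set x; y] \in E)].

Definition edges (T : finType) (adj : rel T) : {set {set T}} :=
  [set [set p.1; p.2] | p in [pred p : T * T | adj p.1 p.2]].

(* [cover X] is the set of endpoints of the edges in [X]. *)
Definition feasible (Pi : graph_property) (T : finType) (adj : rel T)
    (X : {set {set T}}) : bool :=
  (X \subset edges adj) && Pi T (cover X) X.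

Inductive token_rule := TJ | TS.

Definition tj_adjacent (T : finType) : rel {set {set T}} := fun X Y =>
  (#|X :\: Y| == 1) && (#|Y :\: X| == 1).

Definition ts_adjacent (T : finType) : rel {set {set T}} := fun X Y =>
  tj_adjacent X Y &&
  [exists a in X :\: Y, exists b in Y :\: X, a :&: b != set0].

Definition adjacent (rule : token_rule) (T : finType) : rel {set {set T}} :=
  match rule with TJ => @tj_adjacent T | TS => @ts_adjacent T end.

Record instance (Pi : graph_property) := Instance {
  order : nat;
  adj : rel 'I_order;
  adj_sym : symmetric adj;
  adj_irr : irreflexive adj;
  source : {set {set 'I_order}};
  target : {set {set 'I_order}};
  source_feasible : feasible Pi adj source;
  target_feasible : feasible Pi adj target
}.

Definition reconfigurable (Pi : graph_property) (rule : token_rule)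
    (I : instance Pi) : Prop :=
  exists p : seq {set {set 'I_(order I)}},
    [/\ all (feasible Pi (@adj _ I)) (source I :: p),
        path (adjacent rule (T := 'I_(order I))) (source I) p
      & last (source I) p = target I].

(** * Word RAM *)

(* Registers and memory cells hold natural numbers; results are reduced modulo
   [2 ^ w], where [w] is the word length.  Register names, constants and jump
   targets are part of the program text. *)
Inductive instr :=
  | Const of nat & nat         (* r := k *)
  | Move of nat & nat          (* r := s *)
  | Add of nat & nat & nat     (* r := s + t *)
  | Sub of nat & nat & nat     (* r := s - t, or 0 if s < t *)
  | Read of nat & nat          (* r := mem[s] *)
  | Write of nat & nat         (* mem[r] := s *)
  | Jump of nat                (* goto l *)
  | JumpEq of nat & nat & nat  (* if r = s goto l *)
  | JumpLt of nat & nat & nat  (* if r < s goto l *)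
  | Halt of bool.              (* accept or reject *)

Definition program := seq instr.

Record state := State { pc : nat; reg : nat -> nat; mem : nat -> nat }.

Definition update (f : nat -> nat) (i v : nat) : nat -> nat :=
  fun j => if j == i then v else f j.

Definition set_reg (s : state) (r v : nat) : state :=
  State (pc s).+1 (update (reg s) r v) (mem s).

Definition goto (s : state) (l : nat) : state := State l (reg s) (mem s).

Definition step (w : nat) (i : instr) (s : state) : state :=
  let R := reg s in
  match i with
  | Const r k => set_reg s r (k %% 2 ^ w)
  | Move r a => set_reg s r (R a)
  | Add r a b => set_reg s r ((R a + R b) %% 2 ^ w)
  | Sub r a b => set_reg s r (R a - R b)
  | Read r a => set_reg s r (mem s (R a))
  | Write r a => State (pc s).+1 R (update (mem s) (R r) (R a))
  | Jump l => goto s l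
  | JumpEq a b l => goto s (if R a == R b then l else (pc s).+1)
  | JumpLt a b l => goto s (if R a < R b then l else (pc s).+1)
  | Halt _ => s
  end.

(* The verdict of [P] from state [s] if a [Halt] instruction is among the first
   [t] instructions executed; every instruction costs one unit.  A program
   counter outside the program yields no verdict. *)
Fixpoint run (w : nat) (P : program) (t : nat) (s : state) : option bool :=
  if t is t'.+1 then
    match onth P (pc s) with
    | Some (Halt b) => Some b
    | Some i => run w P t' (step w i s)
    | None => None
    end
  else None.

(* The input occupies the memory cells 0, 1, 2, ...; all else is zero. *)
Definition init (x : seq nat) : state := State 0 (fun=> 0) (nth 0 x).

(* [code i x] means that the word sequence [x] is an encoding of the instance
   [i]; an instance may have several encodings and all must be handled.  A
   single program serves all instances.  It must work for every word length [w]
   with [k * size i <= 2 ^ w], in particular for some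
   [w = log2 (size i) + O(1)]. *)
Definition linear_time_decidable (I : Type) (size : I -> nat)
    (code : I -> seq nat -> Prop) (yes : I -> Prop) : Prop :=
  exists (P : program) (k c : nat), forall (i : I) (x : seq nat) (w : nat),
    code i x -> k * size i <= 2 ^ w ->
    exists b : bool,
      run w P (c * size i) (init x) = Some b /\ (b <-> yes i).

(** * Input format *)

(* |V| + |E|, plus one so that the bound also makes sense without vertices. *)
Definition instance_size (Pi : graph_property) (I : instance Pi) : nat :=
  (order I + #|edges (@adj _ I)|).+1.

(* The pairs in [l] list every edge of [E] once, in any order, with the two
   endpoints in any order. *)
Definition lists_edges (T : finType) (l : seq (T * T)) (E : {set {set T}}) :=
  perm_eq [seq [set p.1; p.2] | p <- l] (enum E).

Definition code_vertices (n : nat) (l : seq 'I_n) : seq nat :=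
  size l :: [seq nat_of_ord v | v <- l].

Definition code_edges (n : nat) (l : seq ('I_n * 'I_n)) : seq nat :=
  size l :: flatten [seq [:: nat_of_ord p.1; nat_of_ord p.2] | p <- l].

(* The number of vertices, then the adjacency lists of the vertices 0, 1, ...
   (each preceded by its length, in any order), then the lists of source and
   target edges (each preceded by its length). *)
Definition instance_code (Pi : graph_property) (I : instance Pi)
    (x : seq nat) : Prop :=
  exists (nb : 'I_(order I) -> seq 'I_(order I))
         (ls lt : seq ('I_(order I) * 'I_(order I))),
    [/\ forall u, perm_eq (nb u) (enum (@adj _ I u)),
        lists_edges ls (source I),
        lists_edges lt (target I)
      & x = order I ::
              flatten [seq code_vertices (nb u) | u <- enum 'I_(order I)]
              ++ code_edges ls ++ code_edges lt].

Definition edge_reconfiguration_in_linear_time (rule : token_rule)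
    (Pi : graph_property) : Prop :=
  linear_time_decidable (@instance_size Pi) (@instance_code Pi)
    (@reconfigurable Pi rule).

(* Main.v *)
(* If two distinct feasible solutions are adjacent, each of them is a single
   edge: a clique with at least three vertices shares too few edges with any other
   clique of the same size.  Hence, unless both solutions are single edges, the
   answer is yes exactly if they are equal.  A single edge can be moved to every
   edge under TJ, and to exactly the edges of its connected component under TS.

   Single edges under TJ aside, the answer is therefore yes iff source and target
   have equally many edges and the endpoints of the target lie in a set of reached
   vertices: the endpoints of the source, closed under adjacency by a
   breadth-first search if the rule is TS and the source is a single edge. *)

Require Import Defs.
From mathcomp Require Import all_boot zify.
(* [mem] and other names of Defs are shadowed by those of MathComp. *)
Import Defs.

Set Implicit Arguments.
Unset Strict Implicit.
Unset Printing Implicit Defensive.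

(** * Structured code and a timed program logic *)

(* A code fragment is given its own address, since jumps are absolute. *)
Definition code := nat -> program.

Definition block (p : program) : code := fun=> p.

Definition seqc (c1 c2 : code) : code := fun l =>
  c1 l ++ c2 (l + size (c1 l)).

(** There is no jump on inequality, so a successful test jumps over an unconditional jump that skips
    the body. *)
Definition if_eq (a b : nat) (c : code) : code := fun l =>
  [:: JumpEq a b l.+2; Jump (l.+2 + size (c l.+2))] ++ c l.+2.

Definition while_lt (a b : nat) (c : code) : code := fun l =>
  [:: JumpLt a b l.+2; Jump (l.+3 + size (c l.+2))] ++ c l.+2 ++ [:: Jump l].

Definition basic (i : instr) : bool :=
  match i with
  | Const _ _ | Move _ _ | Add _ _ _ | Read _ _ | Write _ _ => true
  | _ => false
  end.

Section Execution.

Variable w : nat.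

(* The program counters of [s] and [s'] are irrelevant: [c] may be placed
   anywhere. *)
Definition exec (c : code) (s : state) (t : nat) (s' : state) : Prop :=
  forall (p q : program) (d : nat),
    run w (p ++ c (size p) ++ q) (t + d) (State (size p) (reg s) (mem s)) =
    run w (p ++ c (size p) ++ q) d
      (State (size p + size (c (size p))) (reg s') (mem s')).

(** Total correctness. Time is exact in [exec], where it must add up under composition, and is
    relaxed to a bound only here. *)
Definition hoare (c : code) (s : state) (t : nat) (Q : state -> Prop) : Prop :=
  exists t' s', [/\ exec c s t' s', t' <= t & Q s'].

Lemma onth_mid (p q : program) (i : instr) : onth (p ++ i :: q) (size p) = Some i.
Proof. by rewrite onth_cat ltnn subnn. Qed.

Lemma onth_mid1 (p q : program) (i j : instr) :
  onth (p ++ i :: j :: q) (size p).+1 = Some j.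
Proof. by rewrite onth_cat ltnNge leqnSn subSnn. Qed.

Lemma run_jump_eq (P : program) (t l a b l' : nat) (R M : nat -> nat) :
  onth P l = Some (JumpEq a b l') ->
  run w P t.+1 (State l R M) =
    run w P t (State (if R a == R b then l' else l.+1) R M).
Proof. by move=> /= ->. Qed.

Lemma run_halt (P : program) (t l : nat) (b : bool) (R M : nat -> nat) :
  onth P l = Some (Halt b) -> run w P t.+1 (State l R M) = Some b.
Proof. by move=> /= ->. Qed.

Lemma exec_seqc (c1 c2 : code) (s1 s2 s3 : state) (t1 t2 : nat) :
  exec c1 s1 t1 s2 -> exec c2 s2 t2 s3 -> exec (seqc c1 c2) s1 (t1 + t2) s3.
Proof.
move=> e1 e2 p q d; rewrite /seqc -catA -addnA e1.
have := e2 (p ++ c1 (size p)) q d; rewrite size_cat -!catA => ->.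
by rewrite size_cat addnA.
Qed.

Lemma hoare_seqc (c1 c2 : code) (s : state) (t1 t2 : nat) (Q1 Q2 : state -> Prop) :
  hoare c1 s t1 Q1 -> (forall s', Q1 s' -> hoare c2 s' t2 Q2) ->
  hoare (seqc c1 c2) s (t1 + t2) Q2.
Proof.
case=> u1 [s1 [e1 le1 q1]] /(_ _ q1)[u2 [s2 [e2 le2 q2]]].
by exists (u1 + u2), s2; split=> //; [apply: exec_seqc e2 | apply: leq_add].
Qed.

Lemma hoare_seqc_wp (c1 c2 : code) (s : state) (t1 t2 : nat) (Q : state -> Prop) :
  hoare c1 s t1 (fun s' => hoare c2 s' t2 Q) -> hoare (seqc c1 c2) s (t1 + t2) Q.
Proof. by move/hoare_seqc; apply. Qed.

Lemma hoare_weaken (c : code) (s : state) (t1 t2 : nat) (Q1 Q2 : state -> Prop) :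
  hoare c s t1 Q1 -> t1 <= t2 -> (forall s', Q1 s' -> Q2 s') -> hoare c s t2 Q2.
Proof.
case=> u [s' [e le q]] le12 Q12.
by exists u, s'; split=> //; [apply: leq_trans le12 | apply: Q12].
Qed.

Lemma hoare_if_eq (a b : nat) (c : code) (s : state) (t : nat) (Q : state -> Prop) :
  (reg s a = reg s b -> hoare c s t Q) -> (reg s a <> reg s b -> Q s) ->
  hoare (if_eq a b c) s (t + 2) Q.
Proof.
case: (eqVneq (reg s a) (reg s b)) => [eq_ab /(_ eq_ab)|ne_ab _ q].
  case=> u [s' [e le q]] _; exists u.+1, s'; split=> //; last by lia.
  move=> p r d; rewrite /if_eq addSn /= onth_mid /= eq_ab eqxx.
  have := e (p ++ [:: JumpEq a b (size p).+2;
                    Jump ((size p).+2 + size (c (size p).+2))]) r d.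
  rewrite size_cat /= addn2 -!catA /= /goto /= => ->.
  by congr run; rewrite !addnS !addSn.
exists 2, s; split; [|lia | exact/q/eqP] => p r d.
rewrite /if_eq !addSn /= onth_mid /= (negPf ne_ab) onth_mid1.
by rewrite /goto /= add0n !addnS.
Qed.

Lemma exec_while_lt_exit (a b : nat) (c : code) (s : state) :
  reg s b <= reg s a -> exec (while_lt a b c) s 2 s.
Proof.
rewrite leqNgt => /negPf ge_ab p r d.
rewrite /while_lt !addSn /= onth_mid /= ge_ab onth_mid1 /goto /= add0n.
by rewrite size_cat addn1 !addnS ?addSn.
Qed.

Lemma exec_while_lt_step (a b : nat) (c : code) (s s1 s2 : state) (t1 t2 : nat) :
  reg s a < reg s b -> exec c s t1 s1 -> exec (while_lt a b c) s1 t2 s2 ->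
  exec (while_lt a b c) s (t1 + 2 + t2) s2.
Proof.
move=> lt_ab e1 e2 p r d; rewrite -e2 /while_lt.
set l := _.+3 + _; set j := [:: JumpLt a b (size p).+2; Jump l].
(* The successor on the remaining time pays for the jump back to the test. *)
have E := e1 (p ++ j) (Jump (size p) :: r) (t2 + d).+1.
rewrite size_cat addn2 -!catA in E.
have -> : t1 + 2 + t2 + d = (t1 + (t2 + d).+1).+1 by lia.
rewrite /= onth_mid /= lt_ab -!catA; apply: (etrans E).
have -> : (size p).+2 + size (c (size p).+2) = size ((p ++ j) ++ c (size p).+2).
  by rewrite !size_cat /= addn2.
by rewrite !catA [LHS]/= onth_mid.
Qed.

(* [g] is the ghost state of the loop and [mu g] a bound on the time left. *)
Lemma hoare_while_lt (a b : nat) (c : code) (G : Type) (mu : G -> nat)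
    (Inv : G -> state -> Prop) :
  (forall g s, Inv g s -> reg s a < reg s b ->
     exists g' t, hoare c s t (Inv g') /\ t + mu g' + 2 <= mu g) ->
  forall g s, Inv g s ->
    hoare (while_lt a b c) s (mu g + 2)
      (fun s' => reg s' b <= reg s' a /\ exists g', Inv g' s').
Proof.
move=> body g; have [m] := ubnP (mu g).
elim: m g => // m IHm g lt_m s inv_s.
case: (leqP (reg s b) (reg s a)) => [ge_ab|lt_ab].
  by exists 2, s; split; [exact: exec_while_lt_exit | lia | eauto].
have [g' [t [[u [s' [e le inv']]] le_mu]]] := body _ _ inv_s lt_ab.
have [|u2 [s2 [e2 le2 q2]]] := IHm g' _ _ inv'; first lia.
exists (u + 2 + u2), s2; split=> //; last lia.
exact: exec_while_lt_step e e2.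
Qed.

(* Registers beyond the end of [l] hold [0]. *)
Definition at_store (l : seq nat) (m : nat -> nat) (s : state) : Prop :=
  reg s =1 nth 0 l /\ mem s =1 m.

(** Brings a register list to the length that the next assertion displays. *)
Lemma at_store_pad (k : nat) (l : seq nat) (m : nat -> nat) (s : state) :
  at_store l m s -> at_store (l ++ nseq k 0) m s.
Proof.
case=> reg_s mem_s; split=> // r; rewrite reg_s nth_cat nth_nseq if_same.
by case: ltnP => // /(nth_default 0) ->.
Qed.

Lemma hoare_nil (s : state) (t : nat) (Q : state -> Prop) :
  Q s -> hoare (block [::]) s t Q.
Proof. by exists 0, s; split=> // p q d; rewrite addn0. Qed.

Lemma hoare_cons (i : instr) (p : program) (s : state) (t : nat)
    (Q : state -> Prop) :
  basic i -> hoare (block p) (step w i s) t Q ->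
  hoare (block (i :: p)) s t.+1 Q.
Proof.
move=> basic_i [u [s' [e le q]]]; exists u.+1, s'; split=> // p0 r d.
have := e (rcons p0 i) r d; rewrite /block size_rcons !cat_rcons /= addSnnS.
by move=> <-; rewrite onth_mid; case: i basic_i {e}.
Qed.

Lemma update_nth (f : nat -> nat) (l : seq nat) (r v : nat) :
  f =1 nth 0 l -> update f r v =1 nth 0 (set_nth 0 l r v).
Proof. by move=> f_l j; rewrite nth_set_nth /= /update f_l. Qed.

(** * Symbolic execution of single instructions *)

Section Steps.

Variables (l : seq nat) (m : nat -> nat) (s : state) (p : program) (t : nat).
Variable Q : state -> Prop.
Hypothesis at_s : at_store l m s.

Lemma hoare_const (r k : nat) : k < 2 ^ w ->
  (forall s', at_store (set_nth 0 l r k) m s' -> hoare (block p) s' t Q) ->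
  hoare (block (Const r k :: p)) s t.+1 Q.
Proof.
case: at_s => reg_s mem_s lt_k Qs; apply: hoare_cons => //; apply: Qs; split=> //.
by rewrite /= modn_small //; apply: update_nth.
Qed.

Lemma hoare_move (r a : nat) :
  (forall s', at_store (set_nth 0 l r (nth 0 l a)) m s' ->
     hoare (block p) s' t Q) ->
  hoare (block (Move r a :: p)) s t.+1 Q.
Proof.
case: at_s => reg_s mem_s Qs; apply: hoare_cons => //; apply: Qs; split=> //=.
by rewrite reg_s; apply: update_nth.
Qed.

Lemma hoare_add (r a b : nat) : nth 0 l a + nth 0 l b < 2 ^ w ->
  (forall s', at_store (set_nth 0 l r (nth 0 l a + nth 0 l b)) m s' ->
     hoare (block p) s' t Q) ->
  hoare (block (Add r a b :: p)) s t.+1 Q.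
Proof.
case: at_s => reg_s mem_s lt Qs; apply: hoare_cons => //; apply: Qs; split=> //.
by rewrite /= !reg_s modn_small //; apply: update_nth.
Qed.

Lemma hoare_read (r a v : nat) : m (nth 0 l a) = v ->
  (forall s', at_store (set_nth 0 l r v) m s' -> hoare (block p) s' t Q) ->
  hoare (block (Read r a :: p)) s t.+1 Q.
Proof.
case: at_s => reg_s mem_s <- Qs; apply: hoare_cons => //; apply: Qs; split=> //=.
by rewrite reg_s mem_s; apply: update_nth.
Qed.

Lemma hoare_write (r a : nat) :
  (forall s', at_store l (update m (nth 0 l r) (nth 0 l a)) s' ->
     hoare (block p) s' t Q) ->
  hoare (block (Write r a :: p)) s t.+1 Q.
Proof.
case: at_s => reg_s mem_s Qs; apply: hoare_cons => //; apply: Qs; split=> //= j.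
by rewrite /update !reg_s mem_s.
Qed.

End Steps.

End Execution.

(* Runs a [Const], [Move], [Add] or [Write], leaving overflow to [lia]. *)
Ltac simple_step :=
  lazymatch goal with
  | H : at_store _ _ ?s |- hoare _ _ ?s _ _ =>
      first [ apply: (hoare_move H) | apply: (hoare_write H)
            | apply: (hoare_add H); [rewrite /=; lia | ]
            | apply: (hoare_const H); [lia | ]];
      clear s H; rewrite /=; move=> s H
  end.

Ltac read_step E :=
  lazymatch goal with
  | H : at_store _ _ ?s |- hoare _ _ ?s _ _ =>
      apply: (hoare_read H); [by rewrite /= E | ];
      clear s H; rewrite /=; move=> s H
  end.

(** * The program *)

(* Registers [rmark], [roff] and [rqueue] hold the base addresses of three arrays
   of length [n] placed after the input: the marks of the vertices reached so
   far, the positions of the adjacency lists, and the queue of the reached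
   vertices, of which [rh] have been expanded and [rqt] enqueued.  The lists of
   source and target edges have lengths [rms] and [rmt]; the latter occupies the
   cells from [rpt] to [ret].  In [scan] and [check] the interval to be read is
   delimited by [ri] and [re].  Register [ru] is the current vertex while the
   adjacency lists are parsed, and the mark just read afterwards. *)
Local Notation rzero := 0.
Local Notation rone := 1.
Local Notation rn := 2.
Local Notation rp := 9.
Local Notation ru := 10.
Local Notation rt := 11.
Local Notation rms := 3.
Local Notation rmt := 4.
Local Notation ri := 12.
Local Notation re := 13.
Local Notation rpt := 5.
Local Notation ret := 14.
Local Notation roff := 6.
Local Notation rmark := 7.
Local Notation rqueue := 8.
Local Notation rv := 15.
Local Notation rh := 16.
Local Notation rqt := 17.
Local Notation rbad := 18.

Definition skip_lists : code :=
  while_lt ru rn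
    (block [:: Read rt rp; Add rp rp rt; Add rp rp rone; Add ru ru rone]).

(** An edge takes two cells, so the length of an edge list is added twice to reach its last cell. *)
Definition locate : code :=
  block [:: Read rms rp; Move ri rp; Add re rp rms; Add re re rms;
            Add rpt re rone; Read rmt rpt; Add ret rpt rmt; Add ret ret rmt;
            Add roff ret rone; Add rmark roff rn; Add rqueue rmark rn;
            Move rp rone; Move ru rzero].

(** A second pass over the adjacency lists: the offsets are stored behind the input, whose end is
    known only after [locate]. *)
Definition record_offsets : code :=
  while_lt ru rn
    (block [:: Add rt roff ru; Write rt rp; Read rt rp; Add rp rp rt;
               Add rp rp rone; Add ru ru rone]).

(** Initially [ri] points to the cell before the first entry. It is advanced before each read, so
    [re] is the last cell read. *)
Definition scan : code :=
  while_lt ri re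
    (seqc (block [:: Add ri ri rone; Read rv ri; Add rt rmark rv; Read ru rt])
       (if_eq ru rzero
          (block [:: Write rt rone; Add rt rqueue rqt; Write rt rv;
                     Add rqt rqt rone]))).

Definition search : code :=
  while_lt rh rqt
    (seqc (block [:: Add rt rqueue rh; Read rv rt; Add rh rh rone;
                     Add rt roff rv; Read ri rt; Read re ri; Add re ri re])
       scan).

Definition check : code :=
  while_lt ri re
    (seqc (block [:: Add ri ri rone; Read rv ri; Add rt rmark rv; Read ru rt])
       (if_eq ru rzero (block [:: Move rbad rone]))).

(* Under TJ a single edge can jump anywhere, so nothing is left to check. *)
Definition decide (rule : token_rule) : code :=
  seqc (block [:: Const rone 1; Read rn rzero; Move rp rone])
  (seqc skip_lists
  (seqc locate
  (seqc record_offsets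
  (seqc scan
  (seqc (if_eq rms rone
           (if rule is TJ then block [:: Move ret rpt] else search))
  (seqc (block [:: Move ri rpt; Move re ret])
        check)))))).

Definition answer (l : nat) : program :=
  [:: JumpEq rms rmt l.+2; Halt false; JumpEq rbad rzero l.+4; Halt false;
      Halt true].

Definition solver (rule : token_rule) : program :=
  decide rule 0 ++ answer (size (decide rule 0)).

(** * The queue as a list *)

Lemma updateE (f : nat -> nat) (i v j : nat) :
  update f i v j = if j == i then v else f j.
Proof. by []. Qed.

(** The abstract effect of one round of [scan], where the mark of [v] decides membership. *)
Definition push (q : seq nat) (v : nat) : seq nat :=
  if v \in q then q else rcons q v.

Lemma mem_foldl_push (q vs : seq nat) (v : nat) :
  (v \in foldl push q vs) = (v \in q) || (v \in vs).
Proof.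
elim: vs q => [|u vs IHvs] q /=; first by rewrite orbF.
rewrite IHvs inE orbA; congr orb; rewrite /push.
case: ifP => [u_q|_]; last by rewrite mem_rcons inE orbC.
by case: eqP => [->|_]; rewrite ?u_q ?orbF ?orbT.
Qed.

(** Enqueuing only appends, so the vertices already expanded keep their positions. *)
Lemma foldl_push_cat (q vs : seq nat) : exists r, foldl push q vs = q ++ r.
Proof.
elim: vs q => [|u vs IHvs] q /=; first by exists [::]; rewrite cats0.
rewrite /push; case: ifP => _; first exact: IHvs.
by have [r ->] := IHvs (rcons q u); exists (u :: r); rewrite cat_rcons.
Qed.

Lemma nth_cat_mid (T : Type) (x0 : T) (s1 s2 s3 : seq T) (k : nat) :
  k < size s2 -> nth x0 (s1 ++ s2 ++ s3) (size s1 + k) = nth x0 s2 k.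
Proof.
move=> lt_k; rewrite nth_cat ltnNge leq_addr /= addKn.
by rewrite nth_cat lt_k.
Qed.

(** * Layout of the input in memory *)

Section Solver.

Variables (n : nat) (nb : nat -> seq nat) (ms mt : nat) (fs ft : seq nat).

Definition lists (u : nat) : seq nat :=
  flatten [seq size (nb v) :: nb v | v <- iota 0 u].

(** The address of the list of [u]; the successor accounts for cell [0], which holds [n]. *)
Definition pos (u : nat) : nat := (size (lists u)).+1.

Definition input : seq nat := n :: lists n ++ (ms :: fs) ++ (mt :: ft).

Definition len : nat := size input.


Lemma listsS (u : nat) : lists u.+1 = lists u ++ (size (nb u) :: nb u).
Proof.
by rewrite /lists -addn1 iotaD map_cat flatten_cat /= cats0 add0n.
Qed.

Lemma posS (u : nat) : pos u.+1 = pos u + size (nb u) + 1.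
Proof. by rewrite /pos listsS size_cat /=; lia. Qed.

Lemma pos0 : pos 0 = 1.
Proof. by []. Qed.

(** Relates addresses to degrees; both the time of the search and the length of the input are
    bounded through it. *)
Lemma pos_sum (u : nat) : pos u = (\sum_(v <- iota 0 u) (size (nb v)).+1).+1.
Proof.
elim: u => [|u IHu]; first by rewrite pos0 big_nil.
by rewrite posS IHu -[u.+1]addn1 iotaD big_cat big_seq1 /= add0n; lia.
Qed.

Lemma lists_split (u : nat) : u < n ->
  exists r, lists n = lists u ++ (size (nb u) :: nb u) ++ r.
Proof.
move=> lt_un; exists (flatten [seq size (nb v) :: nb v | v <- iota u.+1 (n - u.+1)]).
rewrite catA -listsS /lists -flatten_cat -map_cat -iotaD.
by congr (flatten (map _ (iota 0 _))); lia.
Qed.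

Lemma leq_pos (u v : nat) : u <= v -> pos u <= pos v.
Proof.
move/subnKC <-; elim: (v - u) => [|d IHd]; first by rewrite addn0.
by rewrite addnS posS; lia.
Qed.

(** Each list has at least its length cell. Hence [n < len], and the three arrays of length [n]
    behind the input end below [4 * len]. *)
Lemma ltn_pos (u : nat) : u < pos u.
Proof. by elim: u => [|u IHu] //; rewrite posS; lia. Qed.

Lemma nth_input_list (u k : nat) : u < n -> k < (size (nb u)).+1 ->
  nth 0 input (pos u + k) = nth 0 (size (nb u) :: nb u) k.
Proof.
move=> lt_un lt_k; have [r def_r] := lists_split lt_un.
rewrite /input def_r -!catA -cat_cons -[pos u]/(size (n :: lists u)).
exact: nth_cat_mid.
Qed.

Hypothesis size_fs : size fs = ms + ms.
Hypothesis size_ft : size ft = mt + mt.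
Lemma size_input : len = pos n + (ms + ms).+1 + (mt + mt).+1.
Proof.
by rewrite /len /input /pos -size_fs -size_ft /= !size_cat /= size_cat /=; lia.
Qed.

Hypothesis nb_bound : forall u, u < n -> all (gtn n) (nb u).
Hypothesis fs_bound : all (gtn n) fs.
Hypothesis ft_bound : all (gtn n) ft.

Lemma nth_input_source (k : nat) : k < (size fs).+1 ->
  nth 0 input (pos n + k) = nth 0 (ms :: fs) k.
Proof. by move=> lt_k; exact: (@nth_cat_mid _ _ (n :: lists n)). Qed.

Lemma nth_input_target (k : nat) : k < (size ft).+1 ->
  nth 0 input (pos n + (size fs).+1 + k) = nth 0 (mt :: ft) k.
Proof.
move=> lt_k; rewrite /input -(cats0 (mt :: ft)) catA -cat_cons.
have -> : pos n + (size fs).+1 = size (n :: lists n ++ ms :: fs).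
  by rewrite /= size_cat.
by rewrite nth_cat_mid ?cats0.
Qed.

Lemma input_default (j : nat) : len <= j -> nth 0 input j = 0.
Proof. exact: nth_default. Qed.

Lemma nth_input0 : nth 0 input 0 = n.
Proof. by []. Qed.

(* Otherwise [/=] would unfold addresses and memory contents. *)
Opaque pos input len.

Variable w : nat.
Hypothesis fits : 4 * len <= 2 ^ w.

(** * Parsing the input *)

Lemma hoare_skip_lists (s : state) :
  at_store [:: 0; 1; n; 0; 0; 0; 0; 0; 0; 1] (nth 0 input) s ->
  hoare w skip_lists s (6 * n + 2) (fun s' =>
    exists t, at_store [:: 0; 1; n; 0; 0; 0; 0; 0; 0; pos n; n; t] (nth 0 input) s').
Proof.
move=> at_s; have szL := size_input.
pose Inv k s := k <= n /\ exists t,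
  at_store [:: 0; 1; n; 0; 0; 0; 0; 0; 0; pos k; k; t] (nth 0 input) s.
(* The ghost state counts the lists passed; a round costs four instructions and the two jumps of the
   loop. *)
have loop := @hoare_while_lt w ru rn _ nat (fun k => 6 * (n - k)) Inv _ 0 s.
rewrite -[X in 6 * X]subn0; apply: hoare_weaken; first apply: loop.
- move=> k s1 [le_kn [t at_s1]]; rewrite !(at_s1.1) /= => lt_kn.
  exists k.+1, 4; split; last by lia.
  have := leq_pos lt_kn; rewrite /= posS => le_pos.
  have := nth_input_list lt_kn (ltn0Sn _); rewrite addn0 /= => nth_pos.
  have := ltn_pos n => ltn_n.
  read_step nth_pos; simple_step; simple_step; simple_step.
  apply: hoare_nil; split=> //; exists (size (nb k)).
  by rewrite posS -[k.+1]addn1.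
- by split=> //; exists 0; rewrite pos0; exact: (at_store_pad 2 at_s).
- by [].
move=> s1 [le [k [le_kn [t at_s1]]]]; exists t.
move: le; rewrite !(at_s1.1) /= => le.
by have def_k : k = n by [lia]; rewrite def_k in at_s1.
Qed.

(** The registers from the end of [locate] on: sizes and base addresses stay fixed, and only the
    working registers are parameters. *)
Definition config (p u t i e et v h qt bad : nat) : seq nat :=
  [:: 0; 1; n; ms; mt; pos n + (ms + ms).+1; len; len + n; len + n + n;
      p; u; t; i; e; et; v; h; qt; bad].

Let target_end := pos n + (ms + ms).+1 + mt + mt.

Lemma hoare_locate (t : nat) (s : state) :
  at_store [:: 0; 1; n; 0; 0; 0; 0; 0; 0; pos n; n; t] (nth 0 input) s ->
  hoare w locate s 13 (fun s' =>
    at_store (config 1 0 t (pos n) (pos n + ms + ms) target_end 0 0 0 0)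
      (nth 0 input) s').
Proof.
move=> /(at_store_pad 7) /= at_s; have szL := size_input.
have := ltn_pos n => ltn_n.
have nth_ms : nth 0 input (pos n) = ms.
  by have := nth_input_source (ltn0Sn _); rewrite addn0.
have nth_mt : nth 0 input (pos n + ms + ms + 1) = mt.
  have := nth_input_target (ltn0Sn _); rewrite addn0; apply: etrans.
  by rewrite size_fs; congr nth; lia.
read_step nth_ms; do 4! simple_step; read_step nth_mt; do 7! simple_step.
apply: hoare_nil; rewrite /config /target_end.
have <- : pos n + ms + ms + 1 = pos n + (ms + ms).+1 by lia.
by have <- : pos n + ms + ms + 1 + mt + mt + 1 = len by lia.
Qed.

(** By the last clause the marks and the queue are still blank, as memory behind the input starts at
    zero. *)
Definition offsets (k : nat) (m : nat -> nat) : Prop :=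
  [/\ forall j, j < len -> m j = nth 0 input j,
      forall v, v < k -> m (len + v) = pos v
    & forall j, len + n <= j -> m j = 0].

Lemma hoare_record_offsets (t i e et : nat) (s : state) :
  at_store (config 1 0 t i e et 0 0 0 0) (nth 0 input) s ->
  hoare w record_offsets s (8 * n + 2) (fun s' => exists p u t m,
    at_store (config p u t i e et 0 0 0 0) m s' /\ offsets n m).
Proof.
move=> at_s; have szL := size_input.
pose Inv k s := k <= n /\ exists t m,
  at_store (config (pos k) k t i e et 0 0 0 0) m s /\ offsets k m.
have loop := @hoare_while_lt w ru rn _ nat (fun k => 8 * (n - k)) Inv _ 0 s.
rewrite -[X in 8 * X]subn0; apply: hoare_weaken; first apply: loop.
- move=> k s1 [le_kn [t1 [m [at_s1 [m_in m_off m_0]]]]].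
  rewrite !(at_s1.1) /= => lt_kn.
  exists k.+1, 6; split; last by lia.
  have := leq_pos lt_kn; rewrite /= posS => le_pos.
  have := nth_input_list lt_kn (ltn0Sn _); rewrite addn0 /= => nth_pos.
  have := ltn_pos n => ltn_n.
  simple_step; simple_step.
  (* [pos k] lies inside the input, so the write at [len + k] has not touched the length stored
     there. *)
  have m1_pos : update m (len + k) (pos k) (pos k) = size (nb k).
    rewrite updateE ifN; last by apply/eqP; lia.
    by rewrite m_in //; lia.
  read_step m1_pos; simple_step; simple_step; simple_step.
  apply: hoare_nil; split=> //.
  exists (size (nb k)), (update m (len + k) (pos k)).
  rewrite posS -[k.+1]addn1; split=> //; split=> [j lt_j|v lt_v|j le_j].
  + by rewrite updateE ifN ?m_in //; apply/eqP; lia.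
  + rewrite updateE eqn_add2l; case: eqP => [-> //|/eqP ne_vk].
    by rewrite m_off //; lia.
  by rewrite updateE ifN ?m_0 //; apply/eqP; lia.
- split=> //; exists t, (nth 0 input); rewrite pos0; split=> //; split=> // j le_j.
  by rewrite input_default //; lia.
- by [].
move=> s1 [le [k [le_kn [t1 [m [at_s1 off_m]]]]]].
exists (pos k), k, t1, m; move: le; rewrite !(at_s1.1) /= => le; split=> //.
by rewrite (_ : n = k) //; lia.
Qed.

(** * Marks, queue and breadth-first search *)

Record queue_state (q : seq nat) (m : nat -> nat) : Prop := QueueState {
  queue_input : forall j, j < len -> m j = nth 0 input j;
  queue_offset : forall v, v < n -> m (len + v) = pos v;
  queue_mark : forall v, v < n -> m (len + n + v) = (v \in q);
  queue_nth : forall k, k < size q -> m (len + n + n + k) = nth 0 q k;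
  queue_uniq : uniq q;
  queue_bound : all (gtn n) q
}.

Lemma offsets_queue_state (m : nat -> nat) : offsets n m -> queue_state [::] m.
Proof. by case=> m_in m_off m_0; split=> // v lt_v; rewrite m_0 //; lia. Qed.

(** By the pigeonhole principle the queue fits into its array. *)
Lemma size_queue (q : seq nat) : uniq q -> all (gtn n) q -> size q <= n.
Proof.
move=> uniq_q /allP q_bound; rewrite -(size_iota 0 n).
by apply: uniq_leq_size => // v /q_bound; rewrite mem_iota.
Qed.

Lemma queue_state_push (q : seq nat) (m : nat -> nat) (v : nat) :
  queue_state q m -> v < n -> v \notin q ->
  queue_state (rcons q v)
    (update (update m (len + n + v) 1) (len + n + n + size q) v).
Proof.
case=> m_in m_off m_mark m_nth uniq_q q_bound lt_v v_q; split.
- by move=> j lt_j; rewrite !updateE !ifN ?m_in //; apply/eqP; lia.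
- by move=> u lt_u; rewrite !updateE !ifN ?m_off //; apply/eqP; lia.
- move=> u lt_u; rewrite updateE ifN; last by apply/eqP; lia.
  rewrite updateE eqn_add2l mem_rcons inE.
  by case: eqP => //= _; apply: m_mark.
- move=> k; rewrite size_rcons ltnS => le_k.
  rewrite updateE eqn_add2l nth_rcons; case: (ltngtP k (size q)) => [lt_k||] //.
    by rewrite updateE ifN ?m_nth //; apply/eqP; lia.
  by lia.
- by rewrite rcons_uniq v_q.
by rewrite all_rcons q_bound andbT.
Qed.

Definition ready (et h : nat) (q : seq nat) (s : state) : Prop :=
  exists p u t i e v m,
    at_store (config p u t i e et v h (size q) 0) m s /\ queue_state q m.

Lemma hoare_scan (a : nat) (vs q : seq nat) (m : nat -> nat) (p u t et v h : nat)
    (s : state) :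
  at_store (config p u t a (a + size vs) et v h (size q) 0) m s ->
  queue_state q m -> a + size vs < len ->
  (forall k, k < size vs -> nth 0 input (a + k.+1) = nth 0 vs k) ->
  all (gtn n) vs ->
  hoare w scan s (12 * size vs + 2) (ready et h (foldl push q vs)).
Proof.
move=> at_s q_m lt_len nth_vs /all_nthP vs_bound.
pose q_ k := foldl push q (take k vs).
pose Inv k s := k <= size vs /\ exists p u t v m,
  at_store (config p u t (a + k) (a + size vs) et v h (size (q_ k)) 0) m s /\
  queue_state (q_ k) m.
have loop := @hoare_while_lt w ri re _ nat (fun k => 12 * (size vs - k)) Inv _ 0 s.
rewrite -[X in 12 * X]subn0; apply: hoare_weaken; first apply: loop.
- move=> k s1 [le_k [p1 [u1 [t1 [v1 [m1 [at_s1 q_m1]]]]]]].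
  rewrite !(at_s1.1) /= ltn_add2l => lt_k.
  (* Four instructions to read the mark, at most four to enqueue, two for the test; the loop adds
     two more, which gives [12]. *)
  exists k.+1, (4 + (4 + 2)); split; last by lia.
  have szL := size_input; have := ltn_pos n => ltn_n.
  have := vs_bound 0 k lt_k => /= lt_vk.
  have qS : q_ k.+1 = push (q_ k) (nth 0 vs k).
    by rewrite /q_ (take_nth 0) // -cats1 foldl_cat.
  have m1_vk : m1 (a + k + 1) = nth 0 vs k.
    by rewrite (queue_input q_m1) -?nth_vs -?addnA ?addn1 //; lia.
  have := size_queue (queue_uniq q_m1) (queue_bound q_m1) => le_q.
  have m1_mark := queue_mark q_m1 lt_vk.
  apply: hoare_seqc_wp.
  simple_step; read_step m1_vk; simple_step; read_step m1_mark.
  apply: hoare_nil; move: qS at_s1; rewrite /push.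
  case: (boolP (_ \in _)) => /= vk_q qS at_s1;
    apply: hoare_if_eq; rewrite !(at_s1.1) //=; move=> _.
    split=> //; rewrite qS addnS -[(a + k).+1]addn1.
    by do 5! eexists; split; first exact: at_s1.
  do 4! simple_step.
  apply: hoare_nil; split=> //; rewrite qS size_rcons -[(size _).+1]addn1.
  rewrite addnS -[(a + k).+1]addn1; do 5! eexists; split; first exact: at_s1.
  exact: queue_state_push.
- by split=> //; rewrite /q_ take0 addn0; do 5! eexists; split; first exact: at_s.
- by [].
move=> s1 [le [k [le_k [p1 [u1 [t1 [v1 [m1 [at_s1 q_m1]]]]]]]]].
move: le; rewrite !(at_s1.1) /= => le.
have def_k : k = size vs by lia.
rewrite /ready; move: at_s1 q_m1; rewrite /q_ def_k take_size => at_s1 q_m1.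
by do 7! eexists; split; first exact: at_s1.
Qed.

(** Reachability without paths: the first two clauses put every reachable vertex into [q], and the
    last one, an induction principle, admits no others. *)
Definition least_closed (q : seq nat) : Prop :=
  [/\ {subset fs <= q}, forall u, u \in q -> {subset nb u <= q}
    & forall C : nat -> Prop, (forall v, v \in fs -> C v) ->
        (forall u v, C u -> v \in nb u -> C v) -> forall v, v \in q -> C v].

(* An upper bound on the time left once the first [h] vertices of [q] have been
   expanded. *)
Let time_left (g : nat * seq nat) : nat :=
  \sum_(u <- iota 0 n | u \notin take g.1 g.2) 12 * (size (nb u)).+1.

(** The vertex at position [h] of the duplicate-free queue occurs nowhere earlier, so its expansion
    removes exactly its term. Appended vertices lie beyond the first [h.+1] positions. *)
Lemma time_leftS (h : nat) (q r : seq nat) : uniq q -> all (gtn n) q -> h < size q ->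
  time_left (h, q) = 12 * (size (nb (nth 0 q h))).+1 + time_left (h.+1, q ++ r).
Proof.
move=> uniq_q /all_nthP q_bound lt_h; rewrite /time_left /=.
rewrite takel_cat // (take_nth 0) //; set u := nth 0 q h.
have u_q : u \notin take h q.
  have := take_uniq h.+1 uniq_q; rewrite (take_nth 0) // rcons_uniq.
  by case/andP.
rewrite (bigID (pred1 u)) /=; congr (_ + _); last first.
  by apply: eq_bigl => v; rewrite mem_rcons inE negb_or andbC.
rewrite (eq_bigl (pred1 u)); last first.
  by move=> v /=; case: eqP => [->|_]; rewrite ?u_q ?andbF.
rewrite -big_filter filter_pred1_uniq ?iota_uniq ?big_seq1 // mem_iota /=.
exact: q_bound.
Qed.

Lemma hoare_search (et : nat) (q : seq nat) (s : state) :
  ready et 0 q s -> q =i fs ->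
  hoare w search s (12 * len + 2) (fun s' =>
    exists h q', ready et h q' s' /\ least_closed q').
Proof.
move=> ready_s q_fs; have szL := size_input.
(* Closure under neighbours is claimed only for the expanded vertices, the first [g.1] of the
   queue. *)
pose Inv g s := [/\ g.1 <= size g.2, ready et g.1 g.2 s, {subset fs <= g.2},
  forall k, k < g.1 -> {subset nb (nth 0 g.2 k) <= g.2}
  & forall C : nat -> Prop, (forall v, v \in fs -> C v) ->
      (forall u v, C u -> v \in nb u -> C v) -> forall v, v \in g.2 -> C v].
have loop := @hoare_while_lt w rh rqt _ _ time_left Inv _ (0, q) s.
apply: hoare_weaken; first apply: loop.
- move=> [h q1] s1 [/= le_h [p [u1 [t [i [e [v1 [m [at_s1 q_m]]]]]]]] fs_q nb_q min_q].
  rewrite !(at_s1.1) /= => lt_h; set u := nth 0 q1 h.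
  have lt_u : u < n by have /all_nthP := queue_bound q_m; apply.
  have := size_queue (queue_uniq q_m) (queue_bound q_m) => le_q.
  have := leq_pos lt_u; rewrite /= posS => le_pos.
  have := ltn_pos n => ltn_n.
  have [r def_r] := foldl_push_cat q1 (nb u).
  (* With the two jumps of the loop a round costs [12 * size (nb u) + 11], one less than the term
     that leaves the sum. *)
  exists (h.+1, q1 ++ r), (7 + (12 * size (nb u) + 2)); split; last first.
    have [uniq_q q_bound] := (queue_uniq q_m, queue_bound q_m).
    by rewrite (time_leftS r uniq_q q_bound lt_h) -/u; lia.
  have nth_u := queue_nth q_m lt_h.
  have nth_off := queue_offset q_m lt_u.
  have nth_deg : m (pos u) = size (nb u).
    rewrite (queue_input q_m); last by lia.
    by have := nth_input_list lt_u (ltn0Sn _); rewrite addn0.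
  apply: hoare_seqc_wp.
  simple_step; read_step nth_u; simple_step; simple_step; read_step nth_off.
  read_step nth_deg; simple_step; apply: hoare_nil.
  apply: hoare_weaken; first apply: (hoare_scan at_s1 q_m).
  + by lia.
  + by move=> k lt_k; rewrite nth_input_list.
  + exact: nb_bound.
  + by [].
  move=> s3; rewrite addn1 def_r => ready_s3.
  have sub_q : {subset q1 <= q1 ++ r} by move=> v v_q; rewrite mem_cat v_q.
  split=> //= [||k|C fs_C nb_C v].
  + by rewrite size_cat; lia.
  + by move=> v /fs_q /sub_q.
  + rewrite ltnS leq_eqVlt => /orP[/eqP ->|lt_k] v v_nb.
      rewrite nth_cat lt_h in v_nb.
      by rewrite -def_r mem_foldl_push v_nb orbT.
    rewrite nth_cat (ltn_trans lt_k lt_h) in v_nb.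
    exact/sub_q/(nb_q k).
  rewrite -def_r mem_foldl_push => /orP[|v_nb]; first exact: min_q.
  exact: (nb_C u v (min_q C fs_C nb_C _ (mem_nth 0 lt_h)) v_nb).
- split=> // [v|C fs_C _ v]; first by rewrite q_fs.
  by rewrite q_fs; apply: fs_C.
(* Each adjacency list is paid for once, length cell included, so the total is within [12] times the
   input length. *)
- rewrite leq_add2r /time_left /= take0 big_mkcond -big_distrr /= leq_mul2l /=.
  by have := pos_sum n; lia.
move=> s1 [le [[h q1] [/= le_h ready_s1 fs_q nb_q min_q]]]; exists h, q1.
split=> //; split=> // u u_q.
have [p [u1 [t [i [e [v1 [m [at_s1 q_m]]]]]]]] := ready_s1.
move: le; rewrite !(at_s1.1) /= => le.
(* On exit the whole queue has been expanded, so the index of [u] is below [h]. *)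
by rewrite -(nth_index 0 u_q); apply: nb_q; apply: leq_trans le; rewrite index_mem.
Qed.

(** * Checking the target, and the whole program *)

Lemma hoare_check (a e : nat) (vs q : seq nat) (m : nat -> nat)
    (p u t et v h : nat) (s : state) :
  at_store (config p u t a e et v h (size q) 0) m s ->
  e = a + size vs -> queue_state q m -> a + size vs < len ->
  (forall k, k < size vs -> nth 0 input (a + k.+1) = nth 0 vs k) ->
  all (gtn n) vs ->
  hoare w check s (9 * size vs + 2) (fun s' =>
    [/\ reg s' rzero = 0, reg s' rms = ms, reg s' rmt = mt
      & reg s' rbad = ~~ all [in q] vs]).
Proof.
move=> at_s def_e q_m lt_len nth_vs /all_nthP vs_bound; rewrite def_e in at_s.
pose bad k : nat := ~~ all [in q] (take k vs).
pose Inv k s := k <= size vs /\ exists u t v,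
  at_store (config p u t (a + k) (a + size vs) et v h (size q) (bad k)) m s.
have loop := @hoare_while_lt w ri re _ nat (fun k => 9 * (size vs - k)) Inv _ 0 s.
rewrite -[X in 9 * X]subn0; apply: hoare_weaken; first apply: loop.
- move=> k s1 [le_k [u1 [t1 [v1 at_s1]]]].
  rewrite !(at_s1.1) /= ltn_add2l => lt_k.
  exists k.+1, (4 + (1 + 2)); split; last by lia.
  have szL := size_input; have := ltn_pos n => ltn_n.
  have := vs_bound 0 k lt_k => /= lt_vk.
  have badS : bad k.+1 = if nth 0 vs k \in q then bad k else 1.
    rewrite /bad (take_nth 0) // all_rcons /=.
    by case: (_ \in _).
  have m_vk : m (a + k + 1) = nth 0 vs k.
    by rewrite (queue_input q_m) -?nth_vs -?addnA ?addn1 //; lia.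
  have m_mark := queue_mark q_m lt_vk.
  apply: hoare_seqc_wp.
  simple_step; read_step m_vk; simple_step; read_step m_mark.
  apply: hoare_nil; move: badS at_s1.
  case: (boolP (_ \in _)) => /= vk_q badS at_s1;
    apply: hoare_if_eq; rewrite !(at_s1.1) //=; move=> _.
    split=> //; rewrite badS addnS -[(a + k).+1]addn1.
    by do 3! eexists; exact: at_s1.
  simple_step; apply: hoare_nil; split=> //; rewrite badS.
  by rewrite addnS -[(a + k).+1]addn1; do 3! eexists; exact: at_s1.
- by split=> //; rewrite /bad take0 addn0; do 3! eexists; exact: at_s.
- by [].
move=> s1 [le [k [le_k [u1 [t1 [v1 at_s1]]]]]].
move: le; rewrite !(at_s1.1) /= => le.
have def_k : k = size vs by lia.
by rewrite /bad def_k take_size.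
Qed.

(** For a single edge under TJ the verdict does not depend on the queue, hence [True]. *)
Definition reached (rule : token_rule) (q : seq nat) : Prop :=
  if ms == 1 then (if rule is TS then least_closed q else True) else q =i fs.

Definition accepts (rule : token_rule) (q : seq nat) : bool :=
  ((if rule is TJ then ms == 1 else false) || all [in q] ft).

Lemma hoare_decide (rule : token_rule) :
  hoare w (decide rule) (init input) (79 * len) (fun s' =>
    exists2 q, reached rule q &
    [/\ reg s' rzero = 0, reg s' rms = ms, reg s' rmt = mt
      & reg s' rbad = ~~ accepts rule q]).
Proof.
have szL := size_input; have ltn_n := ltn_pos n.
have at_init : at_store (nseq 10 0) (nth 0 input) (init input).
  by split=> // r; rewrite nth_nseq if_same.
(* The costs of the fragments in program order; [len] is at least [3] and absorbs the constants. *)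
apply: (@hoare_weaken _ _ _
  (3 + (6 * n + 2 + (13 + (8 * n + 2 + (12 * size fs + 2 +
   (12 * len + 2 + 2 + (2 + (9 * size ft + 2)))))))) _ _ _ _ _ (fun s' => id)).
  apply: hoare_seqc_wp.
  move: (init input) at_init => s at_init.
  simple_step; read_step nth_input0; simple_step; apply: hoare_nil.
  apply: (hoare_seqc (hoare_skip_lists at_init)) => {}s [t {}at_init].
  apply: (hoare_seqc (hoare_locate at_init)) => {}s {}at_init.
  apply: (hoare_seqc (hoare_record_offsets at_init)).
  move=> {}s [p [u [{}t [m [{}at_init /offsets_queue_state q_m]]]]].
  rewrite -addnA -size_fs in at_init.
  apply: (hoare_seqc (hoare_scan (q := [::]) at_init q_m _ _ _)) => //.
  - by rewrite size_fs; lia.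
  - by move=> k lt_k; rewrite nth_input_source.
  move=> {at_init}s; set q := foldl _ _ _.
  have q_fs : q =i fs by move=> v; rewrite mem_foldl_push in_nil.
  move=> ready_s.
  (* For a single edge under TJ, [ret] has been set back to [rpt], so that the check will run over
     an empty interval. *)
  pose Q1 s' := exists2 q', reached rule q' &
    exists h et, ready et h q' s' /\
    if (if rule is TJ then ms == 1 else false)
    then et = pos n + (ms + ms).+1 else et = target_end.
  apply: (@hoare_seqc _ _ _ _ _ _ Q1).
    apply: hoare_if_eq.
      have [p1 [u1 [t1 [i1 [e1 [v1 [m1 [at_s q_m1]]]]]]]] := ready_s.
      rewrite !(at_s.1) => /eqP; rewrite [X in is_true X]/= => ms1.
      rewrite /Q1 /reached ms1; case: rule {Q1}.
        apply: (@hoare_weaken _ (block [:: Move ret rpt]) _ 1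
                 _ _ _ _ _ (fun s' => id)) => //.
        clear ready_s; simple_step; apply: hoare_nil; exists q => //.
        exists 0; eexists; split; last by [].
        by do 7! eexists; split; first exact: at_s.
      apply: hoare_weaken; first exact: hoare_search ready_s q_fs.
        by [].
      by move=> s2 [h [q2 [ready_s2 least_q2]]]; exists q2 => //; exists h, target_end.
    have [p1 [u1 [t1 [i1 [e1 [v1 [m1 [at_s q_m1]]]]]]]] := ready_s.
    rewrite !(at_s.1) /= => /eqP/negPf ms1; rewrite /Q1 /reached ms1.
    by exists q => //; exists 0, target_end; split=> //; case: (rule).
  move=> {ready_s}s [q2 reached_q2 [h [et [ready_s]]]].
  have [p2 [u2 [t2 [i2 [e2 [v2 [m2 [at_s q_m2]]]]]]]] := ready_s => {ready_s}.
  rewrite /accepts.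
  case: (if rule is TJ then _ else _) => def_et; rewrite def_et in at_s.
    apply: hoare_seqc_wp; do 2! simple_step; apply: hoare_nil.
    apply: hoare_weaken; first apply: (hoare_check (vs := [::]) at_s _ q_m2) => //.
    + by rewrite addn0.
    + by rewrite /= addn0; lia.
    + by rewrite leq_add2r.
    by move=> s3 [e0 e1 e3 e4]; exists q2.
  apply: hoare_seqc_wp; do 2! simple_step; apply: hoare_nil.
  apply: hoare_weaken; first apply: (hoare_check (vs := ft) at_s _ q_m2) => //.
  + by rewrite size_ft /target_end addnA.
  + by rewrite size_ft; lia.
  + by move=> k lt_k; rewrite -size_fs nth_input_target.
  + by [].
  by move=> s3 [e0 e1 e3 e4]; exists q2.
by rewrite size_fs size_ft; lia.
Qed.

Lemma run_solver (rule : token_rule) (t : nat) : 80 * len <= t ->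
  exists2 q, reached rule q &
    run w (solver rule) t (init input) = Some ((ms == mt) && accepts rule q).
Proof.
have szL := size_input; have ltn_n := ltn_pos n => le_t.
have [u [s [e le_u [q reached_q [e0 ems emt ebad]]]]] := hoare_decide rule.
exists q => //.
(* [answer] executes at most two tests and a halt. *)
have -> : t = u + (t - u - 3).+3 by lia.
set d := t - u - 3; have := e [::] (answer (size (decide rule 0))) d.+3.
rewrite /solver => ->; move: (decide rule 0) => p; rewrite add0n cat0s.
have onth_answer j : onth (p ++ answer (size p)) (size p + j) =
    onth (answer (size p)) j.
  by rewrite onth_cat ltnNge leq_addr addKn.
move: (p ++ _) onth_answer => P onth_answer; move: (onth_answer 0).
rewrite addn0 => /run_jump_eq ->; rewrite ems emt; case: eqP => _; last first.
  by move: (onth_answer 1); rewrite addn1 => /run_halt ->.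
move: (onth_answer 2); rewrite addn2 => /run_jump_eq ->; rewrite ebad e0.
case: (accepts rule q); last first.
  by move: (onth_answer 3); rewrite addn3 => /run_halt ->.
by move: (onth_answer 4); rewrite addn4 => /run_halt ->.
Qed.

End Solver.

(** * Reconfiguration of cliques *)

(** [reconfigurable] freed from the instance record, so that the ends can vary in inductions. *)
Definition reach (Pi : graph_property) (rule : token_rule) (T : finType)
    (adj : rel T) (X Y : {set {set T}}) : Prop :=
  exists p, [/\ all (feasible Pi adj) (X :: p), path (adjacent rule (T := T)) X p
              & last X p = Y].

Section Cliques.

Variables (rule : token_rule) (T : finType) (adj : rel T).
Hypotheses (adj_sym : symmetric adj) (adj_irr : irreflexive adj).

Local Notation feasible := (feasible complete_graph adj).
Local Notation reach := (reach complete_graph rule adj).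

Lemma edgesP (f : {set T}) :
  reflect (exists x y, adj x y /\ f = [set x; y]) (f \in edges adj).
Proof.
apply: (iffP imsetP) => [[[x y] /= xy ->]|[x [y [xy ->]]]]; first by exists x, y.
by exists (x, y).
Qed.

Lemma adj_neq (x y : T) : adj x y -> x != y.
Proof. by apply: contraTneq => ->; rewrite adj_irr. Qed.

Lemma feasible_cover (X : {set {set T}}) (x y : T) : feasible X ->
  x \in cover X -> y \in cover X -> x != y -> [set x; y] \in X.
Proof.
by case/andP=> _ /forall_inP cX /cX /forall_inP cx /cx /implyP; apply.
Qed.

Lemma feasible_edge (X : {set {set T}}) (f : {set T}) : feasible X -> f \in X ->
  exists x y, [/\ adj x y, x != y & f = [set x; y]].
Proof.
case/andP=> /subsetP sX _ /sX /edgesP[x [y [xy ->]]].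
by exists x, y; rewrite (adj_neq xy).
Qed.

Lemma feasible_set1 (f : {set T}) : f \in edges adj -> feasible [set f].
Proof.
move=> f_E; rewrite /feasible sub1set f_E /= /cover big_set1.
case/edgesP: f_E => x [y [xy ->]].
apply/forall_inP => u; rewrite !inE => /pred2P ux.
apply/forall_inP => v; rewrite !inE => /pred2P vx; apply/implyP.
by case: ux vx => -> [] ->; rewrite ?eqxx // setUC.
Qed.

(** A clique has every pair of its vertices as an edge, so its edge set is determined by its vertex
    set. *)
Lemma cover_sub_feasible (X Y : {set {set T}}) : feasible X -> feasible Y ->
  cover Y \subset cover X -> Y \subset X.
Proof.
move=> fX fY /subsetP sYX; apply/subsetP => f f_Y.
have [x [y [xy ne_xy def_f]]] := feasible_edge fY f_Y.
rewrite def_f; apply: feasible_cover => //; apply: sYX; apply/bigcupP.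
  by exists f => //; rewrite def_f !inE eqxx.
by exists f => //; rewrite def_f !inE eqxx orbT.
Qed.

Lemma adjacent_tj (X Y : {set {set T}}) : adjacent rule X Y -> tj_adjacent X Y.
Proof. by case: rule => // /andP[]. Qed.

Lemma tj_adjacent_card (X Y : {set {set T}}) : tj_adjacent X Y -> #|X| = #|Y|.
Proof.
case/andP=> /eqP XY /eqP YX.
by rewrite -(cardsID Y X) -(cardsID X Y) XY YX setIC.
Qed.

(* The edge [e] that leaves [X] has an endpoint [a] that is not in the clique
   [Y]; as [Y] contains the remaining edges of [X], no other edge of [X] can
   contain [a], so the clique [X] consists of [e] alone. *)
Lemma tj_adjacent_single (X Y : {set {set T}}) :
  feasible X -> feasible Y -> tj_adjacent X Y -> #|X| = 1.
Proof.
move=> fX fY /andP[/cards1P[e def_XY] _].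
have : e \in X :\: Y by rewrite def_XY set11.
rewrite inE => /andP[e_Y e_X].
have XY f : f \in X -> f != e -> f \in Y.
  move=> f_X; apply: contraNT => f_Y.
  by rewrite -in_set1 -def_XY inE f_Y.
have [a [b [ne_ab def_e a_Y]]] :
    exists a b, [/\ a != b, e = [set a; b] & a \notin cover Y].
  have [x [y [_ ne_xy def_e]]] := feasible_edge fX e_X.
  case: (boolP (x \in cover Y)) => [x_Y|x_Y]; last by exists x, y.
  exists y, x; rewrite eq_sym setUC; split=> //.
  by apply: contra e_Y => y_Y; rewrite def_e; apply: feasible_cover.
have in_cover (Z : {set {set T}}) f v : f \in Z -> v \in f -> v \in cover Z.
  by move=> f_Z v_f; apply/bigcupP; exists f.
have a_X : a \in cover X by apply: in_cover e_X _; rewrite def_e !inE eqxx.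
have sub_e c : c \in cover X -> c \in e.
  move=> c_X; rewrite def_e !inE; case: eqVneq => //= ne_ca.
  have ac_X := feasible_cover fX c_X a_X ne_ca.
  apply: contraNT a_Y => ne_cb; apply: (in_cover _ [set c; a]).
    apply: XY => //; apply: contraNneq ne_cb => /setP/(_ c).
    by rewrite def_e !inE eqxx (negPf ne_ca) => /esym.
  by rewrite !inE eqxx orbT.
apply/eqP/cards1P; exists e; apply/setP => f; rewrite inE.
apply/idP/eqP => [f_X|-> //]; apply/eqP; rewrite eqEcard.
have [x [y [_ ne_xy def_f]]] := feasible_edge fX f_X.
rewrite {2}def_f def_e !cards2 ne_ab ne_xy leqnn andbT -def_e.
by apply/subsetP => v /(in_cover _ _ _ f_X) /sub_e.
Qed.

Lemma reach_refl (X : {set {set T}}) : feasible X -> reach X X.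
Proof. by move=> fX; exists [::]; rewrite /= fX. Qed.

Lemma reach_step (X Y Z : {set {set T}}) :
  reach X Y -> feasible Z -> adjacent rule Y Z -> reach X Z.
Proof.
case=> p [fp path_p last_p] fZ YZ; exists (rcons p Z).
by rewrite -rcons_cons all_rcons fZ fp rcons_path path_p last_p YZ last_rcons.
Qed.

Lemma reach_ind (P : {set {set T}} -> Prop) (X Y : {set {set T}}) : P X ->
  (forall X' Y', feasible X' -> feasible Y' -> adjacent rule X' Y' -> P X' -> P Y') ->
  reach X Y -> P Y.
Proof.
move=> PX step [p [/= /andP[fX fp] path_p <-]].
elim: p X PX fX fp path_p => //= Z p IHp X PX fX /andP[fZ fp] /andP[XZ path_p].
by apply: IHp => //; apply: step PX.
Qed.

Lemma reach_card (X Y : {set {set T}}) : reach X Y -> #|X| = #|Y|.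
Proof.
apply: (@reach_ind (fun Z => #|X| = #|Z|)) => // X1 Y1 _ _ X1Y1 ->.
exact/tj_adjacent_card/adjacent_tj.
Qed.

(** A solution that can move at all is a single edge, so no first step exists. *)
Lemma reach_eq (X Y : {set {set T}}) : #|X| != 1 -> reach X Y -> Y = X.
Proof.
move=> X1; apply: (@reach_ind (fun Z => Z = X)) => // X2 Y2 fX fY /adjacent_tj XY def_X.
by rewrite -def_X (tj_adjacent_single fX fY XY) in X1.
Qed.

End Cliques.

(** * Moves of single edges *)

Lemma set1D1 (T : finType) (f g : T) : f != g -> [set f] :\: [set g] = [set f].
Proof.
move=> ne_fg; apply/setP => h; rewrite !inE.
by rewrite andbC; case: eqP => //= ->; rewrite ne_fg.
Qed.

Lemma tj_adjacent_set1 (T : finType) (f g : {set T}) :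
  f != g -> tj_adjacent [set f] [set g].
Proof. by move=> ne; rewrite /tj_adjacent !set1D1 // 1?eq_sym // !cards1. Qed.

Lemma reach_tj_set1 (T : finType) (adj : rel T) (f g : {set T}) :
  f \in edges adj -> g \in edges adj ->
  reach complete_graph TJ adj [set f] [set g].
Proof.
move=> f_E g_E; have := reach_refl TJ (feasible_set1 f_E).
case: (eqVneq f g) => [-> //|ne_fg] /reach_step; apply.
  exact: feasible_set1.
exact: tj_adjacent_set1.
Qed.

Lemma reach_ts_set1 (T : finType) (adj : rel T) (X : {set {set T}})
    (f g : {set T}) (v : T) :
  reach complete_graph TS adj X [set f] -> g \in edges adj ->
  v \in f -> v \in g -> reach complete_graph TS adj X [set g].
Proof.
(* Adjacent solutions differ, so the case of equal edges needs no move. *)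
case: (eqVneq f g) => [-> //|ne_fg] reach_f g_E v_f v_g.
apply: reach_step reach_f (feasible_set1 g_E) _.
rewrite /= /ts_adjacent tj_adjacent_set1 //=.
rewrite !set1D1 // 1?eq_sym //.
apply/exists_inP; exists f; first exact: set11.
apply/exists_inP; exists g; first exact: set11.
by apply/set0Pn; exists v; rewrite inE v_f.
Qed.

(** * Correctness *)

(** An ordered pair is recovered from its unordered pair and one bit telling which component comes
    first in the enumeration of [T]; so the arcs inject into edges times [bool]. *)
Lemma handshake_leq (T : finType) (adj : rel T) :
  \sum_(u : T) #|adj u| <= 2 * #|edges adj|.
Proof.
pose A := [set p : T * T | adj p.1 p.2].
have -> : \sum_(u : T) #|adj u| = #|A|.
  rewrite -sum1_card (eq_bigl (fun p => adj p.1 p.2)); last by move=> p; rewrite inE.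
  rewrite -(pair_big_dep xpredT adj (fun _ _ => 1)) /=.
  by apply: eq_bigr => u _; rewrite sum1_card.
rewrite -card_bool -cardsT mulnC -cardsX.
pose h (p : T * T) := ([set p.1; p.2], enum_rank p.1 < enum_rank p.2).
have h_inj : {in A &, injective h}.
  move=> [x y] [z t] _ _ [/= eq_xyzt eq_lt].
  have : x \in [set z; t] by rewrite -eq_xyzt !inE eqxx.
  have : y \in [set z; t] by rewrite -eq_xyzt !inE eqxx orbT.
  have : z \in [set x; y] by rewrite eq_xyzt !inE eqxx.
  have : t \in [set x; y] by rewrite eq_xyzt !inE eqxx orbT.
  rewrite !inE => /pred2P[] t_xy /pred2P[] z_xy; rewrite t_xy z_xy in eq_lt *;
    move=> /pred2P[] y_zt /pred2P[] x_zt; subst=> //.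
  (* For the swapped pair, equal bits force equal ranks. *)
  by case: (ltngtP (enum_rank x) (enum_rank y)) eq_lt => // /val_inj/enum_rank_inj ->.
rewrite -(card_in_imset h_inj); apply: subset_leq_card.
apply/subsetP => _ /imsetP[p p_A ->]; rewrite !inE andbT.
by apply/imsetP; exists p => //; rewrite inE in p_A *.
Qed.

Definition endpoints (n : nat) (l : seq ('I_n * 'I_n)) : seq nat :=
  flatten [seq [:: nat_of_ord p.1; nat_of_ord p.2] | p <- l].

Lemma size_endpoints (n : nat) (l : seq ('I_n * 'I_n)) :
  size (endpoints l) = size l + size l.
Proof. by elim: l => //= p l IHl; rewrite IHl; lia. Qed.

Lemma size_lists_edges (n : nat) (l : seq ('I_n * 'I_n)) (E : {set {set 'I_n}}) :
  lists_edges l E -> size l = #|E|.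
Proof. by move/perm_size; rewrite size_map cardE. Qed.

Lemma endpointsP (n : nat) (l : seq ('I_n * 'I_n)) (E : {set {set 'I_n}}) (v : nat) :
  lists_edges l E ->
  reflect (exists2 u, u \in cover E & v = val u) (v \in endpoints l).
Proof.
move=> /perm_mem lE.
apply: (iffP flatten_mapP) => [[p p_l v_p]|[u /bigcupP[f f_E u_f] ->]].
  have p_E : [set p.1; p.2] \in E by rewrite -mem_enum -lE; apply: map_f.
  move: v_p; rewrite !inE => /pred2P[] ->; [exists p.1|exists p.2] => //;
    by apply/bigcupP; exists [set p.1; p.2] => //; rewrite !inE eqxx ?orbT.
rewrite -mem_enum -lE in f_E; have /mapP[p p_l def_f] := f_E.
by exists p => //; move: u_f; rewrite def_f !inE => /pred2P[] ->; rewrite eqxx ?orbT.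
Qed.

Lemma endpoints_bound (n : nat) (l : seq ('I_n * 'I_n)) : all (gtn n) (endpoints l).
Proof.
by apply/allP => v /flatten_mapP[p _]; rewrite !inE => /pred2P[] -> /=.
Qed.

(** * The verdict of the solver on an encoded instance *)

Section Instance.

Variables (rule : token_rule) (I : instance complete_graph).
Variables (nb : 'I_(order I) -> seq 'I_(order I)).
Variables (ls lt : seq ('I_(order I) * 'I_(order I))).

Hypothesis nbE : forall u, perm_eq (nb u) (enum (@adj _ I u)).
Hypothesis lsE : lists_edges ls (source I).
Hypothesis ltE : lists_edges lt (target I).

Local Notation n := (order I).
Local Notation S := (source I).
Local Notation T := (target I).

(** The solver is verified for lists of plain numbers; numbers that are not vertices get the empty
    list. *)
Definition neighbours (u : nat) : seq nat :=
  if insub u is Some v then map val (nb v) else [::].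

Lemma neighboursE (u : 'I_n) : neighbours u = map val (nb u).
Proof. by rewrite /neighbours valK. Qed.

Lemma mem_nb (u v : 'I_n) : (v \in nb u) = adj u v.
Proof. by rewrite (perm_mem (nbE u)) mem_enum. Qed.

Lemma neighbours_bound (u : nat) : u < n -> all (gtn n) (neighbours u).
Proof.
move=> lt_u; rewrite -[u]/(val (Ordinal lt_u)) neighboursE.
by apply/allP => _ /mapP[v _ ->] /=.
Qed.

Let x := input n neighbours (size ls) (size lt) (endpoints ls) (endpoints lt).

Lemma instance_codeE :
  n :: flatten [seq code_vertices (nb u) | u <- enum 'I_n]
    ++ code_edges ls ++ code_edges lt = x.
Proof.
congr (_ :: flatten _ ++ _); rewrite -val_enum_ord -map_comp.
by apply: eq_map => u; rewrite /code_vertices /= neighboursE size_map.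
Qed.

Lemma size_lists_leq (l : seq ('I_n * 'I_n)) (E : {set {set 'I_n}}) :
  lists_edges l E -> feasible complete_graph (@adj _ I) E ->
  size l <= #|edges (@adj _ I)|.
Proof. by move/size_lists_edges => -> /andP[/subset_leq_card]. Qed.

(** An edge fills at most two cells in the adjacency lists and two in each of the source and target
    lists, hence the factor [6]. *)
Lemma size_code_leq :
  len n neighbours (size ls) (size lt) (endpoints ls) (endpoints lt)
    <= 6 * instance_size I.
Proof.
have szL := @size_input n neighbours _ _ _ _ (size_endpoints ls) (size_endpoints lt).
rewrite szL pos_sum /instance_size.
have -> : \sum_(v <- iota 0 n) (size (neighbours v)).+1 =
    n + \sum_(u : 'I_n) #|@adj _ I u|.
  rewrite -val_enum_ord big_map big_enum /=.
  rewrite (eq_bigr (fun u => 1 + #|@adj _ I u|)).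
    by rewrite big_split /= sum1_card card_ord.
  by move=> u _; rewrite neighboursE size_map (perm_size (nbE u)) -cardE.
have sum_deg : \sum_(u : 'I_n) #|@adj _ I u| <= 2 * #|edges (@adj _ I)|.
  exact: handshake_leq.
have := size_lists_leq lsE (source_feasible I).
have := size_lists_leq ltE (target_feasible I).
by lia.
Qed.

Lemma all_endpointsP (q : seq nat) :
  reflect (forall u, u \in cover T -> val u \in q) (all [in q] (endpoints lt)).
Proof.
apply: (iffP allP) => [q_T u u_T|q_T v].
  by apply: q_T; apply/(endpointsP _ ltE); exists u.
by case/(endpointsP _ ltE) => u u_T -> /=; apply: q_T.
Qed.

Lemma closed_reach (q : seq nat) : size ls = 1 -> size lt = 1 ->
  least_closed neighbours (endpoints ls) q ->
  all [in q] (endpoints lt) <-> reach complete_graph TS (@adj _ I) S T.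
Proof.
rewrite (size_lists_edges lsE) (size_lists_edges ltE).
move=> /eqP/cards1P[e S_e] /eqP/cards1P[g T_g] [sub_q closed_q min_q].
have [/subsetP sS _] := andP (source_feasible I).
have [/subsetP sT _] := andP (target_feasible I).
have e_E : e \in edges (@adj _ I) by apply: sS; rewrite S_e set11.
have g_E : g \in edges (@adj _ I) by apply: sT; rewrite T_g set11.
have coverS : cover S = e by rewrite S_e /cover big_set1.
have coverT : cover T = g by rewrite T_g /cover big_set1.
split=> [/all_endpointsP q_T|reach_ST].
  (* One endpoint of [g] suffices: an edge that contains it can slide to [g]. *)
  have [a [b [_ def_g]]] := edgesP _ _ g_E.
  have a_g : a \in g by rewrite def_g !inE eqxx.
  (* Minimality of [q] is applied to the vertices lying on an edge to which the source can be
     moved. *)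
  pose C u := exists v (f : {set 'I_n}), [/\ val v = u, v \in f
    & reach complete_graph TS (@adj _ I) S [set f]].
  have [|u w [v [f [<- v_f reach_f]]]||v [f [/val_inj -> a_f reach_f]]] :=
    min_q C _ _ (val a) (q_T a _).
  - move=> _ /(endpointsP _ lsE)[v v_S ->].
    exists v, e; split=> //; first by rewrite -coverS.
    by rewrite -S_e; apply: reach_refl; apply: source_feasible.
  - rewrite neighboursE => /mapP[z]; rewrite mem_nb => vz ->.
    exists z, [set v; z]; split=> //; first by rewrite !inE eqxx orbT.
    apply: reach_ts_set1 reach_f _ v_f _; last by rewrite !inE eqxx.
    by apply/edgesP; exists v, z.
  - by rewrite coverT.
  by rewrite T_g; apply: reach_ts_set1 reach_f g_E a_f a_g.
(* Conversely, along a sequence the current solution stays a single edge with both endpoints in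
   [q]. *)
pose P (X : {set {set 'I_n}}) :=
  exists2 f, X = [set f] & forall v, v \in f -> val v \in q.
suff [f T_f f_q] : P T.
  by apply/all_endpointsP => u; rewrite T_f /cover big_set1; apply: f_q.
apply: (@reach_ind TS _ (@adj _ I) P _ _ _ _ reach_ST).
  exists e => // v v_e; apply: sub_q; apply/(endpointsP _ lsE).
  by exists v; rewrite ?coverS.
move=> X Y fX fY /andP[XY /exists_inP[f f_XY /exists_inP[h h_YX]]] meet [f1 def_X f_q].
have /eqP/cards1P[h1 def_Y] : #|Y| = 1.
  by rewrite -(tj_adjacent_card XY) def_X cards1.
move: f_XY h_YX meet; rewrite def_X def_Y !inE => /andP[_ /eqP ->] /andP[_ /eqP ->].
case/set0Pn => v; rewrite inE => /andP[v_f v_h].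
exists h1 => // z z_h.
have [|a [b [ab _ def_h]]] := feasible_edge (@adj_irr _ I) fY (f := h1).
  by rewrite def_Y set11.
(* The new edge shares [v] with the old one, and its other endpoint is a neighbour of [v]. *)
case: (eqVneq z v) => [->|ne_zv]; first exact: f_q.
apply: (closed_q (val v)); first exact: f_q.
rewrite neighboursE map_f // mem_nb.
move: z_h v_h ne_zv; rewrite def_h !inE => /pred2P[] -> /pred2P[] ->; rewrite ?eqxx //.
by rewrite adj_sym.
Qed.

Lemma accepts_reconfigurable (q : seq nat) :
  reached neighbours (size ls) (endpoints ls) rule q ->
  (size ls == size lt) && accepts (size ls) (endpoints lt) rule q <->
  reconfigurable rule I.
Proof.
rewrite -[reconfigurable rule I]/(reach complete_graph rule (@adj _ I) S T).
rewrite /reached /accepts => reached_q.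
have [fS fT] := (source_feasible I, target_feasible I).
have szS := size_lists_edges lsE; have szT := size_lists_edges ltE.
case: (eqVneq (size ls) (size lt)) => [eq_sz|ne_sz]; last first.
  by split=> // /reach_card; rewrite -szS -szT => /eqP; rewrite (negPf ne_sz).
case: (eqVneq (size ls) 1) reached_q => [sz1|sz1].
  case: rule => /= [_|least_q]; last by apply: closed_reach => //; rewrite -eq_sz.
  split=> // _; move: sz1 eq_sz; rewrite szS szT => /eqP/cards1P[e S_e].
  rewrite S_e cards1 => /esym/eqP/cards1P[g T_g].
  rewrite T_g; apply: reach_tj_set1.
    by have /andP[/subsetP sS _] := fS; apply: sS; rewrite S_e set11.
  by have /andP[/subsetP sT _] := fT; apply: sT; rewrite T_g set11.
move=> q_fs; have -> : (if rule is TJ then false else false) = false by case: rule.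
rewrite /=; split=> [/all_endpointsP q_T|].
  (* The target clique lies on the vertices of the source, hence is contained in it, and both have
     equally many edges. *)
  have /eqP eq_ST : T == S.
    rewrite eqEcard -szS -szT eq_sz leqnn andbT.
    apply: (cover_sub_feasible (@adj_irr _ I)) => //; apply/subsetP => u /q_T.
    by rewrite q_fs => /(endpointsP _ lsE)[v v_S /val_inj ->].
  by rewrite eq_ST; apply: reach_refl.
move/(reach_eq (@adj_irr _ I)); rewrite -szS => /(_ sz1) eq_TS.
apply/all_endpointsP => u u_T; rewrite q_fs; apply/(endpointsP _ lsE).
by exists u => //; rewrite -eq_TS.
Qed.

End Instance.

Theorem theorem4 (rule : token_rule) :
  edge_reconfiguration_in_linear_time rule complete_graph.
Proof.
(* The input has at most [6] times [instance_size I] cells; addresses need [4 * len] and the run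
   takes [80 * len]. *)
exists (solver rule), 24, 480 => I _ w [nb [ls [lt [nbE lsE ltE ->]]]] fits.
have le_len := size_code_leq nbE lsE ltE.
rewrite instance_codeE.
have [|||||||q reached_q ->] := @run_solver (order I) (neighbours nb)
  (size ls) (size lt) (endpoints ls) (endpoints lt) _ _ _ _ _ w _ rule (480 * instance_size I) _.
- exact: size_endpoints.
- exact: size_endpoints.
- exact: neighbours_bound.
- exact: endpoints_bound.
- exact: endpoints_bound.
- by lia.
- by lia.
eexists; split; first by [].
exact: (accepts_reconfigurable nbE lsE ltE reached_q).
Qed.
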